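(* Fix a real number $t>0$ and an integer $n\ge 5$. For $1\le d\le n-1$ let $$g_{n,d}(t)=\sum_{i=1}^{\min(d,n-d)} \frac{(n-i-1)!}{(d-i)!\,(n-d-i)!\,(i-1)!}\, t^i .$$ Then for every $2\le d\le n-3$, $$4\big(g_{n,d}(t)^2-g_{n,d-1}(t)g_{n,d+1}(t)\big)\big(g_{n,d+1}(t)^2-g_{n,d}(t)g_{n,d+2}(t)\big)\ \ge\ \big(g_{n,d}(t)g_{n,d+1}(t)-g_{n,d-1}(t)g_{n,d+2}(t)\big)^2,$$ i.e. the sequence $\{g_{n,d}(t)\}_{d=1}^{n-1}$ satisfies the higher order Turán inequality.
   Context: $g_{n,d}(t)=g_{U_{n,d}}(t)$ is Speyer's $g$-polynomial of the uniform matroid of rank $d$ on $n$ elements, given by the displayed formula. *)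

(* Defs.v *)
From mathcomp Require Import all_boot all_order all_algebra.
From mathcomp Require Import reals.

Set Implicit Arguments.
Unset Strict Implicit.
Unset Printing Implicit Defensive.

Import Order.TTheory GRing.Theory Num.Theory.

Local Open Scope ring_scope.

(* Speyer's g-polynomial of the uniform matroid of rank d on n elements,
   evaluated at t.  It is meant for 1 <= d <= n - 1; in the range of summation
   none of the natural-number subtractions truncates. *)
Definition gU (R : realType) (n d : nat) (t : R) : R :=
  \sum_(1 <= i < (minn d (n - d)).+1)
     ((n - i - 1)`!)%:R
       / (((d - i)`!)%:R * ((n - d - i)`!)%:R * ((i - 1)`!)%:R) * t ^+ i.

(* Main.v *)
Require Import Defs.
From mathcomp Require Import all_boot all_order all_algebra.
From mathcomp Require Import reals.
From mathcomp Require Import ring zify.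
From mathcomp Require Import complex.

Set Implicit Arguments.
Unset Strict Implicit.
Unset Printing Implicit Defensive.

Import Order.TTheory GRing.Theory Num.Theory.

Local Open Scope ring_scope.

(** Up to the factor [t], the numbers [g_{n,d}(t)] with [m = n - 2], [e = d - 1]
    are the coefficients of the polynomials [P_m] defined by
    [P_{m+2} = (X + 1) P_{m+1} + t X P_m].  These have only real roots: at a
    nonreal [z] the ratio [P_{m+1}(z) / P_m(z)] never leaves the open cone
    spanned by [1] and [z].  If [p] and [f] have only real roots and
    [p(0) != 0], then so does [p(D) f], because [f'/f] is never real off the
    real line.  Applying this to [q = P_m(D) X^(s+3)] and then to [q(D) X^3]
    shows that the cubic [\sum_k 'C(3, k) c_{s+k} X^k] built from four
    consecutive coefficients has only real roots, and the higher order Turán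
    inequality says that its discriminant is nonnegative. *)

(** * Real-rootedness and the operator [p(D)] *)

Definition real_rooted (C : numClosedFieldType) (p : {poly C}) : Prop :=
  forall z, root p z -> z \is Num.real.

(* [p(D) f], with [D] the derivation. *)
Definition diffop (F : fieldType) (p f : {poly F}) : {poly F} :=
  \sum_(i < size p) p`_i *: f^`(i).

Lemma diffop_wide (F : fieldType) (p f : {poly F}) (n : nat) :
  (size p <= n)%N -> diffop p f = \sum_(i < n) p`_i *: f^`(i).
Proof.
move=> le_pn; rewrite /diffop (big_ord_widen n (fun i => p`_i *: f^`(i))) //.
rewrite [RHS](bigID (fun i : 'I_n => (i < size p)%N)) /=.
rewrite [X in _ + X]big1 ?addr0 // => i.
by rewrite -leqNgt => /leq_sizeP->; rewrite ?scale0r.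
Qed.

(** Products of polynomials act by composition; this is the induction step over the roots of [p]. *)
Lemma diffop_mulXsubC (F : fieldType) (a : F) (p f : {poly F}) :
  diffop (('X - a%:P) * p) f = (diffop p f)^`() - a *: diffop p f.
Proof.
have le_size : (size (('X - a%:P) * p)%R <= (size p).+1)%N.
  by rewrite (leq_trans (size_polyMleq _ _)) // size_XsubC.
rewrite (diffop_wide _ le_size).
rewrite [in X in _ = _ - X](@diffop_wide _ _ _ (size p).+1) //.
rewrite /diffop raddf_sum /=.
under eq_bigr do rewrite mulrBl coefB coefXM coefCM scalerBl.
rewrite sumrB; congr (_ - _).
  rewrite big_ord_recl scale0r add0r.
  by apply: eq_bigr => i _; rewrite derivZ -derivnS lift0.
by rewrite scaler_sumr; apply: eq_bigr => i _; rewrite scalerA.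
Qed.

Lemma diffopZ (F : fieldType) (c : F) (p f : {poly F}) :
  diffop (c *: p) f = c *: diffop p f.
Proof.
rewrite (@diffop_wide _ _ _ (size p)) ?size_scale_leq // scaler_sumr.
by apply: eq_bigr => i _; rewrite coefZ scalerA.
Qed.

(** Only [i = n - k] contributes, so acting on ['X^n] reverses coefficients with falling factorial
    weights. *)
Lemma coef_diffop_Xn (F : fieldType) (p : {poly F}) (n k : nat) :
  (k <= n)%N -> (diffop p 'X^n)`_k = p`_(n - k) *+ n ^_ (n - k).
Proof.
move=> le_kn; rewrite (@diffop_wide _ _ _ (maxn (size p) n.+1)) ?leq_maxl //.
have lt_nk : (n - k < maxn (size p) n.+1)%N by lia.
rewrite coef_sum (bigD1 (Ordinal lt_nk)) //= big1 ?addr0 => [|i ne_i].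
  by rewrite coefZ coef_derivn coefXn subnK // eqxx mulr_natr.
rewrite coefZ coef_derivn coefXn; case: eqP => [e|]; last by rewrite mul0rn mulr0.
by case/eqP: ne_i; apply: val_inj => /=; lia.
Qed.

Lemma diffop_Xn_coef0 (F : fieldType) (p : {poly F}) (n k : nat) :
  (n < k)%N -> (diffop p 'X^n)`_k = 0.
Proof.
move=> lt_nk; rewrite coef_sum big1 // => i _.
rewrite coefZ coef_derivn coefXn; case: eqP => [e|]; last by rewrite mul0rn mulr0.
by exfalso; lia.
Qed.

(** * Preservation of real roots under [p(D)] *)

Section RealRooted.
Variable C : numClosedFieldType.
Implicit Types (p f : {poly C}) (z a : C).

Lemma real_rooted_factor p : real_rooted p ->
  exists2 s : seq C, all (mem Num.real) s
    & p = lead_coef p *: \prod_(a <- s) ('X - a%:P).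
Proof.
move=> rp; have [s def_p] := closed_field_poly_normal p.
have [-> | nz_p] := eqVneq p 0.
  by exists [::]; rewrite // lead_coef0 scale0r.
exists s => //; apply/allP => a sa; apply: rp.
by rewrite def_p rootZ ?lead_coef_eq0 // root_prod_XsubC.
Qed.

(* [w] is the logarithmic derivative [\sum_(a <- s) (z - a)^-1] and [S] is
   [\sum_(a <- s) `|z - a|^-2]. *)
Lemma log_deriv_prod (s : seq C) z : all (mem Num.real) s ->
  z \isn't Num.real ->
  exists w S, [/\ (\prod_(a <- s) ('X - a%:P))^`().[z]
                    = w * (\prod_(a <- s) ('X - a%:P)).[z],
                  w - w^* = - ((z - z^*) * S), 0 <= S & S = 0 -> w = 0].
Proof.
move=> + nr_z; elim: s => [_|a s IHs] /=.
  exists 0, 0; rewrite big_nil derivC horner0 mul0r rmorph0 subrr mulr0 oppr0.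
  by split.
case/andP=> ra /IHs[w [S [dw imw S_ge0 _]]].
have nz : z - a != 0.
  by apply: contraNneq nr_z => /eqP; rewrite subr_eq0 => /eqP->.
have nzc : z^* - a != 0.
  by rewrite -(CrealP ra) -rmorphB /= conjC_eq0.
have gt0 : 0 < (z - a) * (z^* - a).
  by rewrite -{2}(CrealP ra) -rmorphB /= mul_conjC_gt0.
exists ((z - a)^-1 + w), (((z - a) * (z^* - a))^-1 + S); split.
- rewrite big_cons derivM derivXsubC mul1r hornerD !hornerM dw hornerXsubC.
  by field.
- rewrite rmorphD /= fmorphV rmorphB /= (CrealP ra).
  have -> : w^* = w + (z - z^*) * S by rewrite -[_ * S]opprK -imw; ring.
  by field; rewrite nz nzc.
- by rewrite addr_ge0 // invr_ge0 ltW.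
(* With at least one factor [S] is positive, so [S = 0] only for the empty product. *)
- move=> S0; suff: 0 < ((z - a) * (z^* - a))^-1 + S by rewrite S0 ltxx.
  by rewrite ltr_pwDl // invr_gt0.
Qed.

Lemma real_rooted_deriv_sub f a : real_rooted f -> f != 0 ->
  a \is Num.real -> a != 0 -> real_rooted (f^`() - a *: f).
Proof.
move=> rf nz_f ra nz_a z rz; apply/negPn/negP => nr_z.
have [s rs def_f] := real_rooted_factor rf.
have [w [S [dw imw _ S0]]] := log_deriv_prod rs nr_z.
have nz_fz : f.[z] != 0 by apply: contra nr_z => /rf.
have dfz : f^`().[z] = w * f.[z].
  by rewrite {1}def_f derivZ hornerZ dw mulrCA -hornerZ -def_f.
have w_a : w = a.
  apply: (mulIf nz_fz); move/eqP: rz.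
  rewrite hornerD hornerN hornerZ dfz => /eqP.
  by rewrite subr_eq0 => /eqP.
move: imw; rewrite w_a (CrealP ra) subrr => /esym/eqP.
rewrite oppr_eq0 mulf_eq0 subr_eq0 => /orP[/eqP zz|/eqP/S0 w0].
  by case/negP: nr_z; apply/CrealP.
by rewrite -w_a w0 eqxx in nz_a.
Qed.

(** As [p(0) != 0], every root [a] of [p] is real and nonzero, and each linear factor acts as
    [g |-> g' - a g]. *)
Lemma real_rooted_diffop p f : real_rooted p -> p.[0] != 0 ->
  real_rooted f -> f != 0 -> real_rooted (diffop p f).
Proof.
move=> rp p0 rf nz_f; have [s rs def_p] := real_rooted_factor rp.
have nz_lp : lead_coef p != 0.
  by apply: contraNneq p0 => /eqP; rewrite lead_coef_eq0 => /eqP->; rewrite horner0.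
have s0 : 0 \notin s.
  by apply: contra p0; rewrite def_p hornerZ -root_prod_XsubC => /eqP->; rewrite mulr0.
rewrite def_p diffopZ => z; rewrite rootZ //; move: z.
suff [] : real_rooted (diffop (\prod_(a <- s) ('X - a%:P)) f)
       /\ diffop (\prod_(a <- s) ('X - a%:P)) f != 0 by [].
elim: s rs s0 {def_p} => [_ _|a s IHs /= /andP[ra rs]].
  by rewrite big_nil /diffop size_poly1 big_ord1 coefC scale1r.
rewrite inE negb_or eq_sym big_cons diffop_mulXsubC => /andP[nz_a s0].
have [rg nz_g] := IHs rs s0; set g := diffop _ _ in rg nz_g *.
split; first exact: real_rooted_deriv_sub.
(* The derivative has smaller size than [a *: g], so nothing cancels the leading term. *)
rewrite -size_poly_eq0 addrC size_polyDl ?size_polyN ?size_scale ?size_poly_eq0 //.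
exact: lt_size_deriv.
Qed.

(** * From real roots to the higher order Turán inequality *)

Lemma real_rooted_Xn n : real_rooted ('X^n : {poly C}).
Proof.
case: n => [z|n z]; first by rewrite expr0 (negPf (root1 _)).
by rewrite /root hornerXn expf_eq0 /= => /eqP->; rewrite real0.
Qed.

(* The right-hand side is 1/27 of the discriminant of the cubic. *)
Lemma cubic_discriminant_ge0 (a0 a1 a2 a3 : C) p :
  real_rooted p -> size p = 4%N -> a3 \is Num.real ->
  p`_0 = a0 -> p`_1 = 3 * a1 -> p`_2 = 3 * a2 -> p`_3 = a3 ->
  0 <= 4 * (a1 ^+ 2 - a0 * a2) * (a2 ^+ 2 - a1 * a3) - (a1 * a2 - a0 * a3) ^+ 2.
Proof.
move=> rp szp ra3 p0 p1 p2 p3; have [s rs def_p] := real_rooted_factor rp.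
have lp : lead_coef p = a3 by rewrite lead_coefE szp.
have nz_a3 : a3 != 0 by rewrite -lp lead_coef_eq0 -size_poly_eq0 szp.
have szs : size s = 3%N.
  by apply: succn_inj; rewrite -szp {1}def_p lp size_scale // size_prod_XsubC.
case: s szs rs def_p => [|x [|y [|z []]]] //= _ /and4P[rx ry rz _].
rewrite lp !big_cons big_nil mulr1 => def_p.
have prodE : ('X - x%:P) * (('X - y%:P) * ('X - z%:P))
   = Poly [:: - (x * y * z); x * y + x * z + y * z; - (x + y + z); 1] :> {poly C}.
  rewrite /= !cons_poly_def mul0r add0r !(polyCN, polyCD, polyCM).
  by ring.
move: p0 p1 p2; rewrite def_p prodE !coefZ !coef_Poly /= => <-.
have nz3 : 3 != 0 :> C by rewrite pnatr_eq0.
move=> /esym/(canRL (mulKf nz3))-> /esym/(canRL (mulKf nz3))->.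
set e := _ - _.
(* By Vieta, the discriminant is the squared product of the root differences, up to a power of
   [a3]. *)
have -> : e = 27^-1 * (a3 ^+ 2 * ((x - y) * (x - z) * (y - z))) ^+ 2.
  by rewrite /e; field; rewrite ?pnatr_eq0.
rewrite mulr_ge0 ?invr_ge0 ?ler0n // real_exprn_even_ge0 //.
by rewrite !(realM, realB, realX).
Qed.

Lemma higher_turan_of_real_rooted p (s : nat) :
  real_rooted p -> (forall k, (k <= s + 3)%N -> 0 < p`_k) ->
  0 <= 4 * (p`_s.+1 ^+ 2 - p`_s * p`_s.+2) * (p`_s.+2 ^+ 2 - p`_s.+1 * p`_s.+3)
       - (p`_s.+1 * p`_s.+2 - p`_s * p`_s.+3) ^+ 2.
Proof.
move=> rp p_gt0; set N := (s + 3)%N in p_gt0.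
have nzX n : 'X^n != 0 :> {poly C} by rewrite monic_neq0 ?monicXn.
(* First reversal: coefficients of [p] beyond [s + 3] are lost, and [q(0)] is [N!] times [p_N],
   hence nonzero. *)
pose q := diffop p 'X^N.
have qE k : (k <= N)%N -> q`_k = p`_(N - k) *+ N ^_ (N - k) by exact: coef_diffop_Xn.
have q_gt0 k : (k <= N)%N -> 0 < q`_k.
  move=> le_kN; rewrite qE // pmulrn_lgt0 ?ffact_gt0 ?leq_subr //.
  by apply: p_gt0; rewrite leq_subr.
have rq : real_rooted q.
  apply: real_rooted_diffop => //; last exact: real_rooted_Xn.
  by rewrite horner_coef0 gt_eqF ?p_gt0.
(* Second reversal: only [q_0, ..., q_3] survive, that is [p_s, ..., p_(s+3)] in their original
   order. *)
pose h := diffop q 'X^3.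
have rh : real_rooted h.
  apply: real_rooted_diffop => //; last exact: real_rooted_Xn.
  by rewrite horner_coef0 gt_eqF ?q_gt0.
have hE k : (k <= 3)%N -> h`_k = q`_(3 - k) *+ 3 ^_ (3 - k) by exact: coef_diffop_Xn.
pose u : C := N`!%:R.
have hcE k : (k <= 3)%N -> h`_k = 'C(3, k)%:R * (u * p`_(s + k)).
  move=> le_k3; rewrite hE // qE; last by rewrite /N; lia.
  have -> : (N - (3 - k) = s + k)%N by rewrite /N; lia.
  rewrite -mulrnA -[LHS]mulr_natl mulrA -natrM; congr (_%:R * _).
  have le_skN : (s + k <= N)%N by rewrite /N; lia.
  have fE : (N - (s + k) = 3 - k)%N by rewrite /N; lia.
  (* Since [N - (s + k) = 3 - k], the factor [(3 - k)!] of [3 ^_ (3 - k)] completes [N ^_ (s + k)]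
     to [N!], leaving ['C(3, k)]. *)
  rewrite -(ffact_fact le_skN) fE -(bin_sub le_k3) -(bin_ffact 3 (3 - k)).
  by ring.
have sz_h : size h = 4%N.
  apply/eqP; rewrite eqn_leq; apply/andP; split.
    by apply/leq_sizeP => j lt3j; apply: diffop_Xn_coef0.
  rewrite ltnNge; apply/negP => /leq_sizeP/(_ 3 (leqnn _))/eqP.
  rewrite hE // subnn ffactn0 mulr1n gt_eqF // q_gt0 //.
have u_gt0 : 0 < u by rewrite ltr0n fact_gt0.
have := @cubic_discriminant_ge0 (u * p`_s) (u * p`_s.+1) (u * p`_s.+2)
  (u * p`_s.+3) h rh sz_h.
rewrite !hcE // !addnS addn0 /= !mul1r.
rewrite gtr0_real ?mulr_gt0 ?p_gt0 ?/N ?addnS ?addn0 //.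
move=> /(_ isT erefl erefl erefl erefl).
set e := (X in 0 <= X -> _); set e' := (X in _ -> 0 <= X).
have -> : e = u ^+ 4 * e' by rewrite /e /e'; ring.
by rewrite pmulr_rge0 // exprn_gt0.
Qed.

End RealRooted.

(** * The polynomials [P_m]: recurrence, real roots, coefficients *)

(* The coefficient of [z^m] in [1 / (1 - (X + 1) z - t X z^2)]; the terms with
   [j.*2 > m] vanish because their binomial coefficient does. *)
Definition delannoy (F : comNzRingType) (t : F) (m : nat) : {poly F} :=
  \sum_(j < m.+1) 'C(m - j, j)%:R * (t *: 'X) ^+ j * ('X + 1) ^+ (m - j.*2).

Lemma delannoy0 (F : comNzRingType) (t : F) : delannoy t 0 = 1.
Proof. by rewrite /delannoy big_ord1 !expr0 !mulr1. Qed.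

Lemma delannoy1 (F : comNzRingType) (t : F) : delannoy t 1 = 'X + 1.
Proof.
by rewrite /delannoy big_ord_recr big_ord1 /= bin0 !mul1r bin_small ?mul0r ?addr0.
Qed.

(** Pascal's rule splits each term with [j > 0] into one term from each summand on the right. *)
Lemma delannoy_rec (F : comNzRingType) (t : F) (m : nat) :
  delannoy t m.+2
    = ('X + 1) * delannoy t m.+1 + t *: 'X * delannoy t m.
Proof.
rewrite /delannoy; set w : {poly F} := t *: 'X; set y : {poly F} := 'X + 1.
rewrite [in LHS]big_ord_recl [in LHS]big_ord_recr /=.
rewrite [X in _ + (_ + X)](_ : _ = 0) ?addr0; last first.
  by rewrite bin_small ?mul0r // /bump; lia.
rewrite [X in y * X]big_ord_recl mulrDr -addrA; congr (_ + _).
  by rewrite /= !bin0 !expr0 !mul1r -exprS.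
rewrite !mulr_sumr -big_split; apply: eq_bigr => i _.
have le_im : (i <= m)%N by rewrite -ltnS.
rewrite /= /bump leq0n add1n subSS subSn // binS natrD (mulrDl _ _ (w ^+ _)) [LHS]mulrDl doubleS !subSS.
congr (_ + _); last by rewrite exprS; ring.
(* If [m - i.*2] truncates or is zero, the exponent cannot be lowered, but then the binomial
   vanishes. *)
have [lt_i|le_i] := ltnP (m - i) i.+1; first by rewrite bin_small // !mul0r mulr0.
have -> : (m - i.*2 = (m - i.*2.+1).+1)%N by lia.
by rewrite [y ^+ _.+1]exprS; ring.
Qed.

Lemma coef_Xadd1_exp (F : comNzRingType) (n k : nat) :
  (('X + 1) ^+ n : {poly F})`_k = 'C(n, k)%:R.
Proof.
rewrite exprD1n coef_sum; under eq_bigr do rewrite coefMn coefXn.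
have [le_kn|lt_nk] := leqP k n; last first.
  rewrite bin_small // big1 // => i _; case: eqP => [e|]; last by rewrite mul0rn.
  by have := ltn_ord i; lia.
have lt_kn : (k < n.+1)%N by [].
rewrite (bigD1 (Ordinal lt_kn)) //= eqxx big1 ?addr0 // => i ne_i.
by rewrite eq_sym (negPf ne_i : (_ == _ :> nat) = _) mul0rn.
Qed.

(* For nonreal [z], the ratio of consecutive values at [z] stays in the cone
   spanned by [1] and [z], which is closed under [r |-> z / r]. *)
Lemma delannoy_ratio (C : numClosedFieldType) (t z : C) (m : nat) :
  0 < t -> z \isn't Num.real ->
  (delannoy t m).[z] != 0 /\
  exists a b, [/\ 0 < a, 0 < b
    & (delannoy t m.+1).[z] = (a + b * z) * (delannoy t m).[z]].
Proof.
move=> t_gt0 nr_z; elim: m => [|m [nz_m [a [b [a_gt0 b_gt0 ratio]]]]].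
  rewrite delannoy0 delannoy1 hornerC oner_neq0; split=> //.
  exists 1, 1; rewrite !ltr01; split=> //.
  by rewrite hornerD hornerX hornerC; ring.
have nr_ab : a + b * z \isn't Num.real.
  apply: contra nr_z => r_ab.
  have -> : z = (a + b * z - a) / b by field; rewrite gt_eqF.
  by rewrite realM ?realV ?(gtr0_real b_gt0) // realB ?(gtr0_real a_gt0).
have nz_ab : a + b * z != 0 by apply: contraNneq nr_ab => ->; rewrite real0.
split; first by rewrite ratio mulf_neq0.
have conj_ab : (a + b * z)^* = a + b * z^*.
  by rewrite rmorphD rmorphM /= (CrealP (gtr0_real a_gt0)) (CrealP (gtr0_real b_gt0)).
have nz_abc : a + b * z^* != 0 by rewrite -conj_ab conjC_eq0.
have N_gt0 : 0 < (a + b * z) * (a + b * z^*) by rewrite -conj_ab mul_conjC_gt0.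
(* The new ratio is [1 + z + t z / (a + b z)]; multiplying by the conjugate gives [z / (a + b z) =
   (a z + b |z|^2) / |a + b z|^2]. *)
exists (1 + t * b * (z * z^*) / ((a + b * z) * (a + b * z^*))).
exists (1 + t * a / ((a + b * z) * (a + b * z^*))); split.
- rewrite ltr_wpDr // divr_ge0 ?(ltW N_gt0) // mulr_ge0 ?mul_conjC_ge0 //.
  by rewrite mulr_ge0 // ltW.
- by rewrite ltr_wpDr // divr_ge0 ?(ltW N_gt0) // mulr_ge0 // ltW.
- rewrite delannoy_rec hornerD !hornerM hornerZ hornerD hornerX hornerC ratio.
  by field; rewrite nz_ab nz_abc.
Qed.

Lemma real_rooted_delannoy (C : numClosedFieldType) (t : C) (m : nat) :
  0 < t -> real_rooted (delannoy t m).
Proof.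
move=> t_gt0 z rz; apply/negPn/negP => nr_z.
by have [/negP[]] := delannoy_ratio m t_gt0 nr_z.
Qed.

(** The guard [j <= e] excludes terms where [e - j] would truncate to 0 and the second binomial
    become 1. *)
Lemma coef_delannoy (F : comNzRingType) (t : F) (m e : nat) :
  (delannoy t m)`_e
    = \sum_(j < m.+1 | (j <= e)%N) ('C(m - j, j) * 'C(m - j.*2, e - j))%:R * t ^+ j.
Proof.
rewrite coef_sum [RHS]big_mkcond; apply: eq_bigr => j _ /=.
rewrite -polyC_natr exprZn -scalerAr -scalerAl coefZ -mulrA coefCM coefXnM.
case: leqP => _; last by rewrite !mulr0.
by rewrite coef_Xadd1_exp natrM; ring.
Qed.

Lemma coef_delannoy_gt0 (F : numFieldType) (t : F) (m e : nat) :
  0 < t -> (e <= m)%N -> 0 < (delannoy t m)`_e.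
Proof.
move=> t_gt0 le_em; rewrite coef_delannoy (bigD1 ord0) //= ltr_pwDl //.
  by rewrite bin0 mul1n expr0 mulr1 !subn0 ltr0n bin_gt0.
by apply: sumr_ge0 => j _; rewrite mulr_ge0 ?ler0n // exprn_ge0 // ltW.
Qed.

Lemma coef_delannoy_map (F K : comNzRingType) (phi : {rmorphism F -> K})
    (t : F) (m e : nat) :
  (delannoy (phi t) m)`_e = phi (delannoy t m)`_e.
Proof.
rewrite !coef_delannoy rmorph_sum; apply: eq_bigr => j _.
by rewrite rmorphM rmorphXn rmorph_nat.
Qed.

(** * Identification with [gU] and conclusion *)

Lemma gU_delannoy (R : realType) (t : R) (m e : nat) : (e <= m)%N ->
  gU m.+2 e.+1 t = t * (delannoy t m)`_e.
Proof.
move=> le_em; rewrite /gU coef_delannoy big_add1 /= big_mkord.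
set K := minn _ _; have le_K : (K <= m.+1)%N by rewrite /K; lia.
rewrite (big_ord_widen_cond _ xpredT (fun i : nat =>
  ((m.+2 - i.+1 - 1)`!)%:R / (((e.+1 - i.+1)`!)%:R
    * ((m.+2 - e.+1 - i.+1)`!)%:R * ((i.+1 - 1)`!)%:R) * t ^+ i.+1) le_K) /=.
rewrite [X in _ = _ * X](bigID (fun j : 'I_m.+1 => (j < K)%N)) /=.
(* Here [j > m - e]: either [m < j.*2] and the first binomial is zero, or [m - j.*2 < e - j] and the
   second is. *)
rewrite [X in _ = _ * (_ + X)]big1 ?addr0 => [|j /andP[le_je]]; last first.
  rewrite -leqNgt /K => le_Kj; have lt_jm := ltn_ord j.
  have [lt_m|le_m] := ltnP m j.*2.
    by rewrite bin_small ?mul0n ?mul0r //; lia.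
  by rewrite (@bin_small (m - j.*2)) ?muln0 ?mul0r //; lia.
rewrite mulr_sumr; apply: eq_big => [j|j lt_jK]; first by rewrite /K; lia.
have [le_je le_jme] : (j <= e /\ j <= m - e)%N by move: lt_jK; rewrite /K; lia.
have -> : (m.+2 - j.+1 - 1 = m - j)%N by lia.
have -> : (e.+1 - j.+1 = e - j)%N by lia.
have -> : (m.+2 - e.+1 - j.+1 = m - e - j)%N by lia.
have -> : (j.+1 - 1 = j)%N by lia.
have le_j : (j <= m - j)%N by lia.
have le_ej : (e - j <= m - j.*2)%N by lia.
rewrite -(bin_fact le_j); have -> : (m - j - j = m - j.*2)%N by lia.
rewrite -(bin_fact le_ej); have -> : (m - j.*2 - (e - j) = m - e - j)%N by lia.
have nzf k : k`!%:R != 0 :> R by rewrite pnatr_eq0 -lt0n fact_gt0.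
by rewrite !natrM exprS; field; rewrite !nzf.
Qed.

Theorem theorem1p4 (R : realType) (t : R) (n : nat) (ht : 0 < t)
    (hn : (5 <= n)%N) (d : nat) (hd2 : (2 <= d)%N) (hdn : (d <= n - 3)%N) :
  4 * (gU n d t ^+ 2 - gU n (d - 1) t * gU n (d + 1) t)
    * (gU n (d + 1) t ^+ 2 - gU n d t * gU n (d + 2) t)
  >= (gU n d t * gU n (d + 1) t - gU n (d - 1) t * gU n (d + 2) t) ^+ 2.
Proof.
have [s def_d] : exists s, d = s.+2 by exists (d - 2)%N; lia.
have [m def_n] : exists m, n = m.+2 by exists (n - 2)%N; lia.
have le_sm : (s + 3 <= m)%N by lia.
rewrite {}def_d {}def_n subn1 addn1 addn2 /= !gU_delannoy; try lia.
(* Roots live in [R[i]]; the inequality between coefficients is then brought back to [R]. *)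
pose tC : R[i] := (t%:C)%C; have tC_gt0 : 0 < tC by rewrite (ltcR 0).
have turanC := higher_turan_of_real_rooted (real_rooted_delannoy (m := m) tC_gt0)
  (fun k le_k => coef_delannoy_gt0 tC_gt0 (leq_trans le_k le_sm)).
rewrite -subr_ge0; set c := fun k => (delannoy t m)`_k.
have turan : 0 <= 4 * (c s.+1 ^+ 2 - c s * c s.+2)
                    * (c s.+2 ^+ 2 - c s.+1 * c s.+3)
                  - (c s.+1 * c s.+2 - c s * c s.+3) ^+ 2.
  rewrite -(lecR 0) !(rmorphB, rmorphM, rmorphXn) (rmorph_nat (real_complex R)).
  by rewrite /= -!coef_delannoy_map.
set e := (X in 0 <= X) in turan.
(* The inequality is homogeneous of degree 4, so the factor [t] of each [gU] comes out as
   [t ^+ 4]. *)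
set e' := (X in 0 <= X); have -> : e' = t ^+ 4 * e by rewrite /e /e' /c; ring.
by rewrite mulr_ge0 // exprn_ge0 // ltW.
Qed.
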